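(* Let $F$ be an infinitely generated free group. Then the group $\operatorname{Aut}(F)$ is complete.
   Context: A group is complete if its centre is trivial and all of its automorphisms are inner. *)

(* Defs.v *)
From HB Require Import structures.
From mathcomp Require Import all_boot.
From mathcomp Require Import boolp classical_sets cardinality.

Set Implicit Arguments.
Unset Strict Implicit.
Unset Printing Implicit Defensive.

Import Algebra.
Local Open Scope classical_set_scope.
Local Open Scope group_scope.

Definition is_subgroup (G : groupType) (H : set G) : Prop :=
  [/\ H 1, forall x y, H x -> H y -> H (x * y) & forall x, H x -> H x^-1].

Definition generated_subgroup (G : groupType) (B : set G) : set G :=
  smallest (@is_subgroup G) B.

Definition finitely_generated (G : groupType) : Prop :=
  exists2 B : set G, finite_set B & generated_subgroup B = setT.

(* Universal property of a free basis B.  The map to be extended is given as a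
   total function f : G -> H; only its values on B are used. *)
Definition free_basis (G : groupType) (B : set G) : Prop :=
  forall (H : groupType) (f : G -> H),
    (exists phi : {multiplicative G -> H}, forall b, B b -> phi b = f b) /\
    (forall phi psi : {multiplicative G -> H},
       (forall b, B b -> phi b = f b) -> (forall b, B b -> psi b = f b) ->
       phi =1 psi).

Definition free_group (G : groupType) : Prop :=
  exists B : set G, free_basis B.

(* The inverse map is stored as data; it is determined by aut_fun, so two
   automorphisms with the same underlying function are equal (aut_eq). *)
Record aut (G : groupType) : Type := Aut {
  aut_fun :> G -> G;
  aut_inv : G -> G;
  autM : {morph aut_fun : x y / x * y};
  autK : cancel aut_fun aut_inv;
  autVK : cancel aut_inv aut_fun }.

Section AutGroup.
Variable G : groupType.
Implicit Types s t : aut G.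

Lemma aut_eq s t : s =1 t -> s = t.
Proof.
case: s t => [f f' fM fK f'K] [g g' gM gK g'K] /= /funext efg; subst g.
have e : f' = g' by apply/funext => x; rewrite -{1}(g'K x) fK.
by subst g'; congr Aut; exact: Prop_irrelevance.
Qed.

Definition aut_one : aut G :=
  @Aut G id id (fun _ _ => erefl) (fun _ => erefl) (fun _ => erefl).

Lemma aut_compM s t : {morph s \o t : x y / x * y}.
Proof. by move=> x y /=; rewrite !autM. Qed.

Definition aut_comp s t : aut G :=
  @Aut G (s \o t) (aut_inv t \o aut_inv s) (@aut_compM s t)
    (can_comp (autK s) (autK t))
    (can_comp (autVK t) (autVK s)).

Lemma aut_invM s : {morph aut_inv s : x y / x * y}.
Proof. by move=> x y; apply: (can_inj (autK s)); rewrite autM !autVK. Qed.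

Definition aut_inverse s : aut G :=
  @Aut G (aut_inv s) s (@aut_invM s) (autVK s) (autK s).

Lemma aut_compA : associative aut_comp.
Proof. by move=> s t u; apply: aut_eq. Qed.

Lemma aut_comp1s : left_id aut_one aut_comp.
Proof. by move=> s; apply: aut_eq. Qed.

Lemma aut_comps1 : right_id aut_one aut_comp.
Proof. by move=> s; apply: aut_eq. Qed.

Lemma aut_compVs : left_inverse aut_one aut_inverse aut_comp.
Proof. by move=> s; apply: aut_eq => x /=; rewrite autK. Qed.

Lemma aut_compsV : right_inverse aut_one aut_inverse aut_comp.
Proof. by move=> s; apply: aut_eq => x /=; rewrite autVK. Qed.

HB.instance Definition _ := gen_eqMixin (aut G).
HB.instance Definition _ := gen_choiceMixin (aut G).
HB.instance Definition _ := isGroup.Build (aut G)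
  aut_compA aut_comp1s aut_comps1 aut_compVs aut_compsV.

(* The product is composition of functions, right factor applied first. *)
Lemma autME s t x : (s * t) x = s (t x). Proof. by []. Qed.

Lemma aut1E x : (1 : aut G) x = x. Proof. by []. Qed.

Lemma autVE s x : s^-1 x = aut_inv s x. Proof. by []. Qed.

End AutGroup.

Definition center (G : groupType) : set G := [set z | forall x, commute z x].
Arguments center : clear implicits.

Definition inner (G : groupType) (s : aut G) : Prop :=
  exists g : G, forall x, s x = x ^ g.

Definition complete_group (G : groupType) : Prop :=
  center G = [set 1] /\ forall s : aut G, inner s.

(* Main.v *)
(* The automorphisms of [F] whose conjugacy class has at most [|F|] elements are
   exactly the inner ones, so inner automorphisms of [F] are preserved by every
   automorphism of [aut F]; completeness then follows as in Burnside.

   An inner class is indexed by [F].  Conversely, let [s] have a small class and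
   cut [|F|] many disjoint blocks of size [|F|] out of a free basis, which is
   possible since [|F| * |F| = |F|].  As [F] has more subsets than elements,
   some quotient of two multi-transvections from any family indexed by subsets
   of [F] commutes with [s].  In the style of Dixon, Neumann and Thomas this
   yields a block in which every elementary transvection [x |-> x y] is
   approximated by an automorphism commuting with [s], and a commutator turns
   the approximation into the elementary transvection itself.  Applying the
   transvection to [s x] must then give [s x * s y]; comparing reduced words,
   [s x] is [u * x * u^-1] with [u] independent of [x] in the block.  A last
   application of the counting argument, to transvections [x |-> x z] with [x]
   in the block and [z] outside of it, shows that [s z = u * z * u^-1] too. *)
Require Import Defs.
From HB Require Import structures.
From mathcomp Require Import all_boot.
From mathcomp Require Import boolp classical_sets functions cardinality.

Set Implicit Arguments.
Unset Strict Implicit.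
Unset Printing Implicit Defensive.

Import Algebra.
Local Open Scope classical_set_scope.

(** * Cardinal arithmetic *)

(** [D] collects the values [w S] lying outside [S]. It must contain [w D], and a set [S] that puts
    [w D] there collides with [D]. *)
Lemma cantor_collision (T : Type) (w : set T -> T) :
  exists (S D : set T) (x : T), [/\ w S = w D, D x & ~ S x].
Proof.
pose D := [set x | exists2 S : set T, w S = x & ~ S x].
have [DwD|nDwD] := EM (D (w D)); last by case: (nDwD); exists D.
by have [S wS nS] := DwD; exists S, D, (w D).
Qed.

Lemma proj1_sig_inj (T : Type) (P : T -> Prop) : injective (@proj1_sig T P).
Proof.
by move=> [x Px] [y Py] /= xy; subst y; congr exist; exact: Prop_irrelevance.
Qed.

(** By Zorn there is a maximal partial injection; were it neither total nor onto, one more pair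
    could be added. *)
Lemma injection_total (T U : Type) :
  (exists f : T -> U, injective f) \/ (exists f : U -> T, injective f).
Proof.
pose P (G : set (T * U)) := forall p q, G p -> G q -> p.1 = q.1 <-> p.2 = q.2.
have [F PF Ftot|G [PG Gmax]] := @Zorn_bigcup _ P.
  move=> p q [X FX Xp] [Y FY Yq].
  by have [XY|YX] := Ftot X Y FX FY; [apply: (PF Y)|apply: (PF X)] => //;
    [exact: XY|exact: YX].
have [domG|ndom] := EM (forall a, exists b, G (a, b)).
  left; have [f fP] := choice domG; exists f => a a' faa'.
  exact: (PG _ _ (fP a) (fP a')).2.
have [ranG|nran] := EM (forall b, exists a, G (a, b)).
  right; have [f fP] := choice ranG; exists f => b b' fbb'.
  exact: (PG _ _ (fP b) (fP b')).1.
have [a Ga] : exists a, forall b, ~ G (a, b).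
  by apply: contrapT => h; apply: ndom => a; apply: contrapT => h'; apply: h;
    exists a => b Gab; apply: h'; exists b.
have [b Gb] : exists b, forall a, ~ G (a, b).
  by apply: contrapT => h; apply: nran => b; apply: contrapT => h'; apply: h;
    exists b => a' Gab; apply: h'; exists a'.
case: (Gmax (G `|` [set (a, b)])).
  by split=> [p Gp|sub]; [left|apply: (Ga b); apply: sub; right].
move=> [a1 b1] [a2 b2] [G1|[-> ->]] [G2|[-> ->]] //=;
  first exact: (PG _ _ G1 G2).
- by split=> h; [case: (Ga b1)|case: (Gb a1)]; rewrite -h.
- by split=> h; [case: (Ga b2)|case: (Gb a2)]; rewrite h.
Qed.

(** * Injections from the square of an infinite type *)

Section Square.
Variables (T : Type) (e : nat -> T).
Hypothesis e_inj : injective e.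

Let field (G : set ((T * T) * T)) : set T := [set a | exists c, G ((a, a), c)].

(* [G] is the graph of an injection [A * A -> A], where [A := field G]. *)
Let is_pairing (G : set ((T * T) * T)) := [/\
  forall a b c, G ((a, b), c) -> [/\ field G a, field G b & field G c],
  forall a b, field G a -> field G b -> exists c, G ((a, b), c) &
  forall p q, G p -> G q -> p.1 = q.1 <-> p.2 = q.2].

(** Starting from a countable pairing makes every field infinite, so that values of [e] are
    available as tags. *)
Let nat_graph : set ((T * T) * T) :=
  [set ((e m, e n), e (pickle (m, n))) | m in setT & n in setT].

Let is_pairing_nat : is_pairing nat_graph.
Proof.
have fe m : field nat_graph (e m) by exists (e (pickle (m, m))), m => //;
  exists m.
have fE a : field nat_graph a -> exists m, a = e m.
  by move=> [c [m _ [n _ [? _ _]]]]; exists m.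
split.
- by move=> _ _ _ [m _ [n _ [<- <- <-]]]; split; exact: fe.
- move=> a b /fE[m ->] /fE[n ->]; exists (e (pickle (m, n))); exists m => //.
  by exists n.
- move=> _ _ [m _ [n _ <-]] [m' _ [n' _ <-]] /=; split.
    by move=> [/e_inj -> /e_inj ->].
  by move=> /e_inj /(pcan_inj pickleK) [-> ->].
Qed.

Let exists_maximal_pairing : exists G, [/\ is_pairing G, nat_graph `<=` G &
  forall G', is_pairing G' -> G `<=` G' -> G' `<=` G].
Proof.
(* Adjoining [nat_graph] to each candidate lets the empty chain qualify too. *)
have [F PF Ftot|G [PG Gmax]] := @Zorn_bigcup _ [set G | is_pairing (nat_graph
  `|` G)].
  rewrite /=; set H := _ `|` _.
  (* Any two elements of the union lie in a single pairing, because the family is a chain. *)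
  have two p q : H p -> H q -> exists X, [/\ is_pairing X, X `<=` H, X p & X q].
    move=> [Gp|[X FX Xp]] [Gq|[Y FY Yq]].
    - by exists nat_graph; split => // r Gr; left.
    - exists (nat_graph `|` Y); split; [exact: PF| |by left|by right].
      by move=> r [Gr|Yr]; [left|right; exists Y].
    - exists (nat_graph `|` X); split; [exact: PF| |by right|by left].
      by move=> r [Gr|Yr]; [left|right; exists X].
    - have [XY|YX] := Ftot X Y FX FY.
        exists (nat_graph `|` Y); split; [exact: PF| |right;
          exact: XY|by right].
        by move=> r [Gr|Yr]; [left|right; exists Y].
      exists (nat_graph `|` X); split; [exact: PF| |by right|right; exact: YX].
      by move=> r [Gr|Yr]; [left|right; exists X].
  have fS X : X `<=` H -> field X `<=` field H by move=> XH a [c Xc];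
    exists c; apply: XH.
  split.
  - move=> a b c Hp; have [X [[PX _ _] XH Xp _]] := two _ _ Hp Hp.
    by have [fa fb fc] := PX _ _ _ Xp; split; apply: fS; eauto.
  - move=> a b [c Hac] [d Hbd]; have [X [[_ PX _] XH Xa Xb]] := two _ _ Hac Hbd.
    have [k Xk] := PX a b (ex_intro _ c Xa) (ex_intro _ d Xb).
    by exists k; apply: XH.
  - move=> p q Hp Hq; have [X [[_ _ PX] XH Xp Xq]] := two _ _ Hp Hq.
    exact: PX.
exists (nat_graph `|` G); split => // G' PG' sG'.
have e' : nat_graph `|` G' = G' by apply/seteqP; split=> p; [case=> // ?;
  apply: sG'; left|right].
have [sub|nsub] := EM (G' `<=` G); first by move=> p /sub; right.
case: (Gmax G'); last by rewrite /= e'.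
by split=> // p Gp; apply: sG'; right.
Qed.

(** Let [A] be the field of a maximal pairing. If the complement of [A] injects into [A], so does
    [T], and the pairing of [A] serves for [T]. Otherwise a disjoint copy of [A] would enlarge the
    pairing. *)
Lemma pairing_exists : exists f : T * T -> T, injective f.
Proof.
have [G [[Gf Gt Gi] natG Gmax]] := exists_maximal_pairing.
pose A := field G.
have Ae n : A (e n).
  by exists (e (pickle (n, n))); apply: natG; exists n => //; exists n.
have /choice[f fP] : forall p, exists c, A p.1 -> A p.2 -> G (p, c).
  move=> [a b]; have [[Aa Ab]|nA] := EM (A a /\ A b).
    by have [c] := Gt a b Aa Ab; exists c.
  by exists a => ? ?; case: nA.
have fA a b : A a -> A b -> A (f (a, b)).
  by move=> Aa Ab; have [] := Gf _ _ _ (fP (a, b) Aa Ab).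
have fI a b a' b' : A a -> A b -> A a' -> A b' ->
    f (a, b) = f (a', b') -> a = a' /\ b = b'.
  move=> Aa Ab Aa' Ab' efab.
  by have [_ /(_ efab)[]] := Gi _ _ (fP (a, b) Aa Ab) (fP (a', b') Aa' Ab').
have [[g gI]|[g gI]] := injection_total {x | ~ A x} {x | A x}.
  have /choice[h hP] : forall x, exists t, (A x /\ t = f (e 0, x)) \/
      exists y : {x | ~ A x}, x = sval y /\ t = f (e 1, sval (g y)).
    move=> x; have [Ax|nAx] := EM (A x); first by exists (f (e 0, x)); left.
    by exists (f (e 1, sval (g (exist _ x nAx)))); right;
      exists (exist _ x nAx).
  have hA x : A (h x).
    by case: (hP x) => [[Ax ->]|[y [_ ->]]]; apply: fA => //; exact: svalP.
  have hI : injective h.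
    move=> x x'; case: (hP x) => [[Ax ->]|[y [-> ->]]];
      case: (hP x') => [[Ax' ->]|[y' [-> ->]]] /fI.
    - by case.
    - by case=> //; [exact: svalP|move=> /e_inj].
    - by case=> //; [exact: svalP|move=> /e_inj].
    - case=> //; [exact: svalP|exact: svalP|].
      by move=> _ /proj1_sig_inj /gI ->.
  exists (fun p => f (h p.1, h p.2)) => -[a b] [a' b'] /= /fI[] // /hI -> /hI
    ->.
  by [].
(* [lift] keeps [a] in [A] or, for [i] true, moves it to the copy of [A] outside [A]. *)
pose lift (i : bool) (a : T) (Aa : A a) := if i then sval (g (exist _ a Aa))
  else a.
have gnA x : ~ A (sval (g x)) by case: (g x).
have liftA i a (Aa : A a) : A (lift i a Aa) -> i = false.
  by case: i => // /gnA.
have liftI i a (Aa : A a) j b (Ab : A b) : lift i a Aa = lift j b Ab -> i = j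
  /\ a = b.
  case: i j => -[] //=.
  - by move=> /proj1_sig_inj /gI [->].
  - by move=> gab; case: (gnA (exist _ a Aa)); rewrite gab.
  - by move=> gab; case: (gnA (exist _ b Ab)); rewrite -gab.
pose c i j a b := f (e (pickle (i : bool, j : bool)), f (a, b)).
have Ac (i j : bool) a b (Aa : A a) (Ab : A b) : A (c i j a b) by do 2?apply:
  (fA).
(* [N] treats the pairs with a coordinate in the copy and takes its values there, so it cannot clash
   with [G]; the tag in [c] records which coordinates were lifted. *)
pose N : set ((T * T) * T) := [set p | exists i j a b (Aa : A a) (Ab : A b),
  (i || j) /\ p = ((lift i a Aa, lift j b Ab), lift true (c i j a b) (Ac i j a
    b Aa Ab))].
have fieldN x : field (G `|` N) x <-> exists i a (Aa : A a), x = lift i a Aa.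
  split=> [[d [Gx|[i [j [a [b [Aa [Ab [_ [-> _ _]]]]]]]]]]|].
  - by exists false, x, (ex_intro _ d Gx).
  - by exists i, a, Aa.
  case=> -[] [a [Aa ->]]; last by case: (Aa) => d Gd; exists d; left.
  eexists; right; exists true, true, a, a, Aa, Aa; split => //.
have : is_pairing (G `|` N).
  split.
  - move=> x y z [Gp|[i [j [a [b [Aa [Ab [_ [-> -> ->]]]]]]]]].
      have [Ax Ay Az] := Gf _ _ _ Gp.
      by split; apply/fieldN; exists false;
        [exists x, Ax|exists y, Ay|exists z, Az].
    split; apply/fieldN; [by exists i, a, Aa|by exists j, b, Ab|].
    by exists true, (c i j a b), (Ac i j a b Aa Ab).
  - move=> x y /fieldN[i [a [Aa ->]]] /fieldN[j [b [Ab ->]]].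
    case ij: (i || j); first by eexists; right; exists i, j, a, b, Aa, Ab;
      split.
    move: ij; case: i => //; case: j => //= _.
    by exists (f (a, b)); left; exact: (fP (a, b)).
  - move=> p q [Gp|Np] [Gq|Nq]; first exact: Gi.
    + case: p Gp => -[x y] z /Gf[Ax Ay Az].
      case: Nq => [i [j [a [b [Aa [Ab [ij ->]]]]]]] /=; split.
        by move=> [xE yE]; move: ij;
          rewrite (@liftA i a Aa) -?xE // (@liftA j b Ab) -?yE.
      by move=> zE; case: (gnA (exist _ (c i j a b) (Ac i j a b Aa Ab)));
        rewrite -zE.
    + case: q Gq => -[x y] z /Gf[Ax Ay Az].
      case: Np => [i [j [a [b [Aa [Ab [ij ->]]]]]]] /=; split.
        by move=> [xE yE]; move: ij;
          rewrite (@liftA i a Aa) ?xE // (@liftA j b Ab) ?yE.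
      by move=> zE; case: (gnA (exist _ (c i j a b) (Ac i j a b Aa Ab)));
        rewrite zE.
    + case: Np => [i [j [a [b [Aa [Ab [ij ->]]]]]]].
      case: Nq => [i' [j' [a' [b' [Aa' [Ab' [ij' ->]]]]]]].
      rewrite /fst /snd; split.
        case=> /liftI[ii aa] /liftI[jj bb]; subst i' j' a' b'.
        by congr lift; exact: Prop_irrelevance.
      move=> /liftI[_ /fI]; case => //; [exact: fA|exact: fA|].
      move=> /e_inj /(pcan_inj pickleK) [ii jj] /fI; case => // aa bb.
      by subst i' j' a' b'; congr pair; congr lift; exact: Prop_irrelevance.
move=> /Gmax sGN.
(* By maximality [N] lies in [G], yet lifted elements are outside [A]. *)
have /Gf[] : G ((lift true (e 0) (Ae 0), lift true (e 0) (Ae 0)),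
    lift true _ (Ac true true _ _ (Ae 0) (Ae 0))).
  by apply: sGN => [p|]; [left|right;
    exists true, true, (e 0), (e 0), (Ae 0), (Ae 0)].
by move=> h _ _; have := liftA _ _ _ h.
Qed.

End Square.

(** The length is stored too: [n0 0] may itself be a value of [f], so nested pairs alone do not show
    where a list ends. *)
Lemma seq_injection (T : Type) (n0 : nat -> T) (f : T * T -> T) :
  injective n0 -> injective f -> exists g : seq (T * bool) -> T, injective g.
Proof.
move=> nI fI.
pose c (l : T * bool) := f (l.1, n0 l.2).
pose h (s : seq (T * bool)) := foldr (fun l t => f (c l, t)) (n0 0) s.
exists (fun s => f (n0 (size s), h s)) => s t /fI[/nI].
elim: s t => [|[x a] s IH] [|[y b] t] //= [/IH st] /fI[/fI[-> /nI ab] /st ->].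
by case: a b ab => [] [].
Qed.

Local Open Scope group_scope.

(** * Reduced words *)

Section Morphisms.
Variables (G H : groupType) (phi : G -> H).
Hypothesis phiM : {morph phi : x y / x * y}.

Lemma morph_one : phi 1 = 1.
Proof. by apply: (@mulgI _ (phi 1)); rewrite -phiM !mulg1. Qed.

Lemma morph_inv x : phi x^-1 = (phi x)^-1.
Proof. by apply: (@mulgI _ (phi x)); rewrite -phiM !mulgV morph_one. Qed.

End Morphisms.

Section Words.
Variable I : eqType.
Implicit Types (l m : I * bool) (s t : seq (I * bool)).

Definition inv_letter l := (l.1, ~~ l.2).

Lemma inv_letterK : involutive inv_letter.
Proof. by case=> i e; rewrite /inv_letter /= negbK. Qed.

Definition noncancel l m := m != inv_letter l.

Definition reduced := sorted noncancel.

Definition push l s :=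
  if s is m :: t then if m == inv_letter l then t else l :: s else [:: l].

Lemma push_reduced l s : reduced s -> reduced (push l s).
Proof.
case: s => //= m s ms; case: eqVneq => [_|ne]; first exact: path_sorted ms.
by rewrite /= /noncancel ne.
Qed.

Lemma push_cons l s : reduced (l :: s) -> push l s = l :: s.
Proof. by case: s => //= m s /andP[/negPf ->]. Qed.

Lemma pushK l s : reduced s -> push (inv_letter l) (push l s) = s.
Proof.
case: s => [|m s] /=; first by rewrite inv_letterK eqxx.
move=> ms; case: eqVneq => [em|ne] /=; last by rewrite inv_letterK eqxx.
by rewrite -em push_cons.
Qed.

Lemma push_sub l s : {subset map fst (push l s) <= l.1 :: map fst s}.
Proof.
case: s => //= m s i; case: ifP => // _ is_; by rewrite !inE is_ !orbT.
Qed.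

Definition word := {s : seq (I * bool) | reduced s}.
Definition empty_word : word := exist _ [::] isT.
Definition push_word l (r : word) : word :=
  exist _ (push l (val r)) (push_reduced l (valP r)).

Lemma push_wordK l : cancel (push_word l) (push_word (inv_letter l)).
Proof. by move=> r; apply: val_inj; rewrite /= pushK //; case: r. Qed.

Lemma push_wordVK l : cancel (push_word (inv_letter l)) (push_word l).
Proof. by move=> r; rewrite -{1}(inv_letterK l) push_wordK. Qed.

End Words.

Section Eval.
Variables (F : groupType) (I : choiceType) (b : I -> F).
Implicit Types (l m : I * bool) (s t : seq (I * bool)).

Definition eval_letter l : F := if l.2 then b l.1 else (b l.1)^-1.
Definition eval s : F := foldr (fun l g => eval_letter l * g) 1 s.

Lemma eval_letterV l : eval_letter (inv_letter l) = (eval_letter l)^-1.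
Proof. by case: l => i [] //=; rewrite /eval_letter /= invgK. Qed.

Lemma eval_cat s t : eval (s ++ t) = eval s * eval t.
Proof. by elim: s => [|l s IH] /=; rewrite ?mul1g // IH mulgA. Qed.

Lemma eval_push l s : eval (push l s) = eval_letter l * eval s.
Proof.
case: s => //= m s; case: eqVneq => //= ->.
by rewrite eval_letterV mulVKg.
Qed.

Lemma eval_inv s : (eval s)^-1 = eval (rev (map (@inv_letter I) s)).
Proof.
elim: s => [|l s IH] /=; first by rewrite invg1.
by rewrite invgM rev_cons -cats1 eval_cat IH /= mulg1 eval_letterV.
Qed.

Lemma morph_eval_eq (H : groupType) (phi psi : F -> H) s :
    {morph phi : x y / x * y} -> {morph psi : x y / x * y} ->
    {in map fst s, phi \o b =1 psi \o b} ->
  phi (eval s) = psi (eval s).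
Proof.
move=> phiM psiM; elim: s => [|l s IH] /= e; first by rewrite !morph_one.
have el : phi (b l.1) = psi (b l.1) by apply: e; rewrite mem_head.
rewrite phiM psiM IH; last by move=> i is_; apply: e; rewrite inE is_ orbT.
by rewrite /eval_letter; case: l.2; rewrite ?morph_inv // el.
Qed.

(* Van der Waerden's trick, with the value of a permutation of the reduced
   words recorded alongside: a group acting on reduced words so that [eval] is
   equivariant. *)
Record word_perm := WordPerm {
  wp_fun : word I -> word I;
  wp_inv : word I -> word I;
  wp_val : F;
  wp_funK : cancel wp_fun wp_inv;
  wp_invK : cancel wp_inv wp_fun;
  wp_eval : forall r, eval (val (wp_fun r)) = wp_val * eval (val r) }.

Lemma word_perm_eq p q :
  wp_fun p =1 wp_fun q -> wp_val p = wp_val q -> p = q.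
Proof.
case: p q => [f f' x fK f'K fx] [g g' y gK g'K gx] /= /funext fg xy.
subst g y; have e : f' = g' by apply/funext => r; rewrite -{1}(g'K r) fK.
by subst g'; congr WordPerm; exact: Prop_irrelevance.
Qed.

Lemma wp_one_eval r : eval (val (r : word I)) = 1 * eval (val r).
Proof. by rewrite mul1g. Qed.

Definition wp_one :=
  @WordPerm id id 1 (fun _ => erefl) (fun _ => erefl) wp_one_eval.

Lemma wp_mul_eval p q r : eval (val ((wp_fun p \o wp_fun q) r)) =
  wp_val p * wp_val q * eval (val r).
Proof. by rewrite /= !wp_eval mulgA. Qed.

Definition wp_mul p q := @WordPerm (wp_fun p \o wp_fun q) (wp_inv q \o wp_inv p)
  (wp_val p * wp_val q) (can_comp (@wp_funK p) (@wp_funK q))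
  (can_comp (@wp_invK q) (@wp_invK p)) (wp_mul_eval p q).

Lemma wp_inverse_eval p r :
  eval (val (wp_inv p r)) = (wp_val p)^-1 * eval (val r).
Proof. by rewrite -{2}(wp_invK p r) wp_eval mulKg. Qed.

Definition wp_inverse p :=
  @WordPerm (wp_inv p) (wp_fun p) (wp_val p)^-1 (@wp_invK p) (@wp_funK p)
    (wp_inverse_eval p).

Lemma wp_mulA : associative wp_mul.
Proof. by move=> p q r; apply: word_perm_eq => //=; rewrite mulgA. Qed.

Lemma wp_mul1p : left_id wp_one wp_mul.
Proof. by move=> p; apply: word_perm_eq => //=; rewrite mul1g. Qed.

Lemma wp_mulp1 : right_id wp_one wp_mul.
Proof. by move=> p; apply: word_perm_eq => //=; rewrite mulg1. Qed.

Lemma wp_mulVp : left_inverse wp_one wp_inverse wp_mul.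
Proof.
by move=> p; apply: word_perm_eq => [r|] /=; rewrite ?wp_funK ?mulVg.
Qed.

Lemma wp_mulpV : right_inverse wp_one wp_inverse wp_mul.
Proof.
by move=> p; apply: word_perm_eq => [r|] /=; rewrite ?wp_invK ?mulgV.
Qed.

HB.instance Definition _ := gen_eqMixin word_perm.
HB.instance Definition _ := gen_choiceMixin word_perm.
HB.instance Definition _ := isGroup.Build word_perm
  wp_mulA wp_mul1p wp_mulp1 wp_mulVp wp_mulpV.

Lemma wp_letter_eval l r :
  eval (val (push_word l r)) = eval_letter l * eval (val r).
Proof. exact: eval_push. Qed.

Definition wp_letter l : word_perm :=
  @WordPerm (push_word l) (push_word (inv_letter l)) (eval_letter l)
    (@push_wordK _ l) (@push_wordVK _ l) (@wp_letter_eval l).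

Lemma wp_letterV l : wp_letter (inv_letter l) = (wp_letter l)^-1.
Proof. by apply: word_perm_eq => //=; rewrite eval_letterV. Qed.

End Eval.

(** The form of freeness suited to words: letters are indices, and uniqueness compares two morphisms
    without mentioning [f]. *)
Definition free_family (F : groupType) (I : Type) (b : I -> F) : Prop :=
  forall (H : groupType) (f : I -> H),
    (exists phi : {multiplicative F -> H}, forall i, phi (b i) = f i) /\
    (forall phi psi : {multiplicative F -> H},
       (forall i, phi (b i) = psi (b i)) -> phi =1 psi).

Lemma free_basis_family (F : groupType) (B : set F) :
  free_basis B -> free_family (fun i : set_type B => val i).
Proof.
move=> freeB H f.
(* The value 1 off [B] is a filler. *)
pose f' x := if pselect (B x) is left Bx then f (exist _ x (mem_set Bx)) else 1.
split.
  have [[phi phiE] _] := freeB H f'; exists phi => -[x Bx].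
  rewrite phiE /=; last exact: set_mem.
  rewrite /f'; case: pselect => [Bx'|]; last by case; exact: set_mem.
  by congr f; exact: val_inj.
move=> phi psi e; apply: (freeB H phi).2 => // x Bx.
by rewrite -(e (exist _ x (mem_set Bx))).
Qed.

(** * Normal forms and supports in a free group *)

Section FreeFamily.
Variables (F : groupType) (I : choiceType) (b : I -> F).
Hypothesis b_free : free_family b.
Implicit Types (f : I -> F) (phi psi : F -> F) (g h : F).

Let multiplicative_of (H : groupType) (phi : F -> H)
    (phiM : {morph phi : x y / x * y}) : {multiplicative F -> H} :=
  HB.pack phi (isMultiplicative.Build F H phi phiM).

Lemma morph_ext (H : groupType) (phi psi : F -> H) :
    {morph phi : x y / x * y} -> {morph psi : x y / x * y} ->
  (forall i, phi (b i) = psi (b i)) -> phi =1 psi.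
Proof.
move=> phiM psiM e.
have := (b_free (phi \o b)).2 (multiplicative_of phiM) (multiplicative_of psiM).
by apply.
Qed.

Lemma endo_exists f : exists phi : F -> F,
  {morph phi : x y / x * y} /\ forall i, phi (b i) = f i.
Proof.
have [[phi phiE] _] := b_free f.
by exists phi; split=> // x y; exact: gmulfM.
Qed.

Definition endo f : F -> F := sval (cid (endo_exists f)).

Lemma endoM f : {morph endo f : x y / x * y}.
Proof. exact: (svalP (cid (endo_exists f))).1. Qed.

Lemma endoE f i : endo f (b i) = f i.
Proof. exact: (svalP (cid (endo_exists f))).2. Qed.

(** Let the generators act on reduced words by pushing letters. Applying [psi g] to the empty word
    yields a reduced word; it evaluates to [g] because [psi g] records the value [g]; and a reduced
    word rebuilds itself since none of its pushes cancels. *)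
Lemma normal_form_exists : exists nf : F -> seq (I * bool),
  [/\ forall g, reduced (nf g), forall g, eval b (nf g) = g &
      forall s, reduced s -> nf (eval b s) = s].
Proof.
have [[psi psiE] _] := b_free (fun i => wp_letter b (i, true)).
have psi_val g : wp_val (psi g) = g.
  move: g; apply: (@morph_ext _ (fun g => wp_val (psi g)) id) => // [x y|i].
    by rewrite gmulfM.
  by rewrite psiE.
have psi_letter l : psi (eval_letter b l) = wp_letter b l.
  case: l => i [] /=; first exact: psiE.
  rewrite /eval_letter /= morph_inv; last exact: gmulfM.
  by rewrite psiE -wp_letterV.
exists (fun g => val (wp_fun (psi g) (empty_word I))); split=> [g|g|s].
- exact: valP.
- by rewrite wp_eval psi_val /= mulg1.
- elim: s => [|l s IH] ls /=.
    by rewrite morph_one //; exact: gmulfM.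
  by rewrite gmulfM psi_letter /= IH ?push_cons //; exact: path_sorted ls.
Qed.

Definition nf : F -> seq (I * bool) := sval (cid normal_form_exists).

Lemma nf_reduced g : reduced (nf g).
Proof. by have [] := svalP (cid normal_form_exists). Qed.

Lemma nfK g : eval b (nf g) = g.
Proof. by have [] := svalP (cid normal_form_exists). Qed.

Lemma evalK s : reduced s -> nf (eval b s) = s.
Proof. by have [_ _] := svalP (cid normal_form_exists); apply. Qed.

Lemma nf_one : nf 1 = [::].
Proof. exact: (@evalK [::]). Qed.

Lemma nf_basis i : nf (b i) = [:: (i, true)].
Proof. by rewrite -(@evalK [:: (i, true)]) //= mulg1. Qed.

Lemma basis_inj : injective b.
Proof. by move=> i j /(congr1 nf); rewrite !nf_basis => -[]. Qed.

Lemma nf_letter l g : nf (eval_letter b l * g) = push l (nf g).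
Proof.
by rewrite -[in LHS](nfK g) -eval_push evalK // push_reduced // nf_reduced.
Qed.

(** Pushing the letters of [g] one by one onto [nf h] only adds a letter in front or deletes the
    front one. *)
Lemma nf_mul g h : exists s t, [/\ nf (g * h) = s ++ t,
  {subset s <= nf g} & {subset t <= nf h}].
Proof.
rewrite -[in g * h](nfK g); elim: (nf g) => [|l u [s [t [e su th]]]] /=.
  by exists [::], (nf h); rewrite mul1g; split.
rewrite -mulgA nf_letter e.
case: s t su th {e} => [|m s] [|m' t] /= su th.
- by exists [:: l], [::]; split => // x; rewrite !inE => ->.
- case: eqP => _.
    by exists [::], t; split => // x xt; apply: th; rewrite inE xt orbT.
  by exists [:: l], (m' :: t); split => // x; rewrite !inE => ->.
- rewrite cats0; case: eqP => _.
    exists s, [::]; rewrite cats0; split => // x xs.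
    by rewrite inE su ?orbT // inE xs orbT.
  exists [:: l, m & s], [::]; rewrite cats0; split => // x.
  by rewrite inE => /orP[/eqP ->|/su xu]; rewrite inE ?eqxx ?xu ?orbT.
- case: eqP => _.
    exists s, (m' :: t); split => // x xs.
    by rewrite inE su ?orbT // inE xs orbT.
  exists [:: l, m & s], (m' :: t); split => // x.
  by rewrite inE => /orP[/eqP ->|/su xu]; rewrite inE ?eqxx ?xu ?orbT.
Qed.

Definition support g : seq I := map fst (nf g).

Lemma supp_basis i : support (b i) = [:: i].
Proof. by rewrite /support nf_basis. Qed.

Lemma supp_eval s : {subset support (eval b s) <= map fst s}.
Proof.
elim: s => [|l s IH] i; first by rewrite /support nf_one.
rewrite /support /= nf_letter => /push_sub; rewrite !inE => /orP[->//|/IH ->].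
by rewrite orbT.
Qed.

Lemma suppM g h : {subset support (g * h) <= support g ++ support h}.
Proof.
by move=> i; rewrite -{1}(nfK g) -{1}(nfK h) -eval_cat => /supp_eval;
  rewrite map_cat.
Qed.

Lemma suppV g : {subset support g^-1 <= support g}.
Proof.
move=> i; rewrite -{1}(nfK g) eval_inv => /supp_eval.
rewrite map_rev mem_rev -map_comp => h;
  suff <- : map (fst \o @inv_letter I) (nf g) = support g by [].
exact: eq_map.
Qed.

Lemma agree_supp (H : groupType) (phi psi : F -> H) g :
    {morph phi : x y / x * y} -> {morph psi : x y / x * y} ->
  {in support g, phi \o b =1 psi \o b} -> phi g = psi g.
Proof. by move=> phiM psiM e; rewrite -(nfK g); apply: morph_eval_eq. Qed.

Lemma fix_supp phi g : {morph phi : x y / x * y} ->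
  {in support g, forall i, phi (b i) = b i} -> phi g = g.
Proof. by move=> phiM e; apply: (@agree_supp _ phi id). Qed.

(** With [i] absent from [g], putting the letter [i] before or after [nf g] gives reduced words.
    Both are the normal form of one element, so a nonempty [nf g] would begin with [i]. *)
Lemma commute_basis g i : i \notin support g -> commute g (b i) -> g = 1.
Proof.
move=> ig; rewrite /commute -{1 2}(nfK g) -[b i]/(eval_letter b (i, true)).
have ne m : m \in nf g -> m.1 != i.
  by move=> mg; apply: contraNneq ig => <-; apply: map_f.
have e2 : reduced ((i, true) :: nf g).
  move: (nf_reduced g) ne; rewrite /reduced; case: (nf g) => //= m s -> /(_ m).
  rewrite mem_head andbT => /(_ isT); apply: contraNneq => ->; exact: eqxx.
have e1 : reduced (rcons (nf g) (i, true)).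
  move: (nf_reduced g) ne; rewrite /reduced; case: (nf g) => //= m s ms ne.
  rewrite rcons_path ms /=.
  have := ne _ (mem_last m s); apply: contraNneq => em.
  by rewrite -[i]/((i, true).1) em.
have -> : eval b (nf g) * eval_letter b (i, true) =
    eval b (rcons (nf g) (i, true)).
  by rewrite -cats1 eval_cat /= mulg1.
rewrite -[eval_letter b _ * _]/(eval b (_ :: _)) => /(congr1 nf).
rewrite !evalK // -[in RHS](nfK g) {e1 e2}; move: ne (nfK g);
  case: (nf g) => [|m s] ne <- //.
by move=> [em _]; have := ne m (mem_head _ _); rewrite em eqxx.
Qed.

End FreeFamily.

(** * Transvections commuting with an automorphism of small class *)

(** A cardinality bound: the class of [s] lies in the image of a map from [T]. *)
Definition small_class (T : Type) (G : groupType) (s : G) : Prop :=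
  exists f : T -> G, forall t : G, exists x, f x = s ^ t.

Lemma aut_commute (G : groupType) (s t : aut G) (x : G) :
  commute s t -> s (t x) = t (s x).
Proof. by move=> /(congr1 (fun u : aut G => u x)). Qed.

Lemma first_occurrence (I : eqType) (i : I) (s : seq (I * bool)) :
  i \in map fst s ->
  exists p e q, s = p ++ (i, e) :: q /\ i \notin map fst p.
Proof.
elim: s => //= -[k e] s IH; rewrite inE /=; case: eqVneq => [-> _|ki /= /IH].
  by exists [::], e, s.
by move=> [p [e' [q [-> ip]]]]; exists ((k, e) :: p), e', q;
  rewrite /= inE negb_or ki.
Qed.

Lemma cat_suffix (L : eqType) (s1 s2 s t : seq L) (l : L) :
  s1 ++ l :: s2 = s ++ t -> l \notin s -> exists s3, t = s3 ++ l :: s2.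
Proof.
elim: s s1 => [|m s IH] [|m1 s1] /=.
- by move=> <- _; exists [::].
- by move=> <- _; exists (m1 :: s1).
- by move=> [-> _]; rewrite mem_head.
- by move=> [_ /IH h]; rewrite inE negb_or => /andP[_ /h].
Qed.

Section Transvections.
Variables (F : groupType) (I : choiceType) (b : I -> F).
Hypothesis b_free : free_family b.
Implicit Types (s t h : aut F) (m : I -> option I) (g u w : F).
Local Notation supp := (support b_free).

Lemma aut_ext s t : (forall i, s (b i) = t (b i)) -> s = t.
Proof.
by move=> e; apply/aut_eq/(morph_ext b_free) => //; exact: autM.
Qed.

Definition multiplier m i : F := if m i is Some k then b k else 1.

Section Transvection.
Variable m : I -> option I.
(** Multipliers are themselves fixed, so dividing by them inverts the map. *)
Hypothesis m_ok : forall i k, m i = Some k -> m k = None.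

Let fwd := endo b_free (fun i => b i * multiplier m i).
Let bwd := endo b_free (fun i => b i * (multiplier m i)^-1).

Let fwd_mult i : fwd (multiplier m i) = multiplier m i.
Proof.
rewrite /multiplier; case e: (m i) => [k|]; last exact/morph_one/endoM.
by rewrite /fwd endoE /multiplier (m_ok e) mulg1.
Qed.

Let bwd_mult i : bwd (multiplier m i) = multiplier m i.
Proof.
rewrite /multiplier; case e: (m i) => [k|]; last exact/morph_one/endoM.
by rewrite /bwd endoE /multiplier (m_ok e) invg1 mulg1.
Qed.

Let fwdK : cancel fwd bwd.
Proof.
apply: (@morph_ext _ _ _ b_free _ (bwd \o fwd) id) => // [x y|i] /=.
  by rewrite /fwd /bwd !endoM.
by rewrite /fwd endoE {1}/bwd endoM -/bwd bwd_mult /bwd endoE mulgVK.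
Qed.

Let bwdK : cancel bwd fwd.
Proof.
apply: (@morph_ext _ _ _ b_free _ (fwd \o bwd) id) => // [x y|i] /=.
  by rewrite /fwd /bwd !endoM.
rewrite /bwd endoE {1}/fwd endoM (morph_inv (endoM b_free _)) -/fwd fwd_mult.
by rewrite /fwd endoE mulgK.
Qed.

Definition transvection : aut F := @Aut F fwd bwd (endoM b_free _) fwdK bwdK.

Lemma transvectionE i : transvection (b i) = b i * multiplier m i.
Proof. exact: endoE. Qed.

Lemma transvectionVE i : transvection^-1 (b i) = b i * (multiplier m i)^-1.
Proof. exact: endoE. Qed.

End Transvection.

Lemma elementary_exists i k : i != k ->
  exists t, t (b i) = b i * b k /\ forall l, l != i -> t (b l) = b l.
Proof.
move=> ik; pose m l := if l == i then Some k else None.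
have m_ok l r : m l = Some r -> m r = None.
  by rewrite /m; case: eqP => // _ [<-]; rewrite eq_sym (negPf ik).
exists (transvection m_ok); split=> [|l /negPf li].
  by rewrite transvectionE /multiplier /m eqxx.
by rewrite transvectionE /multiplier /m li mulg1.
Qed.

(* Cantor: the transvections multiplying [b (a x)] by [b (k x)] for [x] in a
   set [S] are too many for the conjugates of [s] by them to be distinct. *)
Lemma small_commuting_transvection s (a k : F -> I) :
    small_class F s -> injective a -> (forall x y, a x <> k y) ->
  exists h, [/\ commute s h,
    exists x, h (b (a x)) = b (a x) * b (k x),
    forall i, (forall x, a x <> i) -> h (b i) = b i &
    forall x, {subset supp (h (b (a x))) <= [:: a x; k x]}].
Proof.
move=> [f fP] a_inj ak.
pose m (S : set F) i := if pselect (exists2 x, S x & a x = i) is left e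
  then Some (k (s2val (cid2 e))) else None.
have mE (S : set F) x : S x -> m S (a x) = Some (k x).
  move=> Sx; rewrite /m; case: pselect => [e|]; last by case; exists x.
  by congr (Some (k _)); apply: a_inj; exact: (s2valP' (cid2 e)).
have mN (S : set F) i : (forall x, S x -> a x <> i) -> m S i = None.
  by move=> Si; rewrite /m; case: pselect => // -[x Sx ax]; case: (Si x Sx).
have m_ok S i l : m S i = Some l -> m S l = None.
  rewrite /m; case: pselect => // e [<-]; apply: mN => x _; exact: ak.
pose t S := transvection (@m_ok S).
(* [w S] is an index of the conjugate by [(t S)^-1]; a collision of [w] makes two such conjugates
   equal. *)
have /choice[w wP] : forall S, exists x, f x = s ^ (t S)^-1 by move=> S;
  exact: fP.
have [S [D [x [wSD Dx nSx]]]] := cantor_collision w.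
have tk R (y : F) : t R (b (k y)) = b (k y).
  by rewrite transvectionE /multiplier mN ?mulg1 // => z _; exact: ak.
have tVk R (y : F) : (t R)^-1 (b (k y)) = b (k y).
  by rewrite transvectionVE /multiplier mN ?invg1 ?mulg1 // => z _; exact: ak.
(* Equal conjugates make this quotient commute with [s]. As [x] is in [D] but not in [S], the factor
   [b (k x)] survives in the image of [b (a x)]. *)
exists ((t S)^-1 * t D); split.
- apply/commgP; rewrite -conjg_fix conjgM.
  by rewrite -wP wSD wP -conjgM mulVg conjg1.
- exists x; rewrite autME transvectionE /multiplier mE //.
  rewrite autM tVk transvectionVE /multiplier mN ?invg1 ?mulg1 //.
  by move=> y Sy /a_inj e; apply: nSx; rewrite -e.
- move=> i ai; rewrite autME transvectionE /multiplier mN ?mulg1 //.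
  by rewrite transvectionVE /multiplier mN ?invg1 ?mulg1.
- move=> y; rewrite autME.
  have mult R : multiplier (m R) (a y) = 1 \/ multiplier (m R) (a y) = b (k y).
    have [Ry|nRy] := EM (R y); first by right; rewrite /multiplier mE.
    by left; rewrite /multiplier mN // => z Rz /a_inj e; apply: nRy; rewrite -e.
  have supp_mult R : {subset supp (multiplier (m R) (a y)) <= [:: k y]}.
    by case: (mult R) => -> i; rewrite ?supp_basis // /support nf_one.
  have -> : (t S)^-1 (t D (b (a y))) =
      b (a y) * (multiplier (m S) (a y))^-1 * multiplier (m D) (a y).
    rewrite transvectionE autM transvectionVE; congr (_ * _).
    by case: (mult D) => ->; [exact/morph_one/autM|rewrite tVk].
  move=> i /suppM; rewrite mem_cat => /orP[/suppM|/supp_mult]; last first.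
    by rewrite !inE => ->; rewrite orbT.
  rewrite mem_cat supp_basis => /orP[|/suppV/supp_mult]; rewrite !inE => -> //.
  by rewrite orbT.
Qed.

(** * Elementary transvections on a block of basis elements *)

Section Blocks.
Variables (s : aut F) (E : F * (F * F) -> I).
Hypotheses (s_small : small_class F s) (E_inj : injective E).

(** A diagonal argument: if every block had a bad pair, moving along all these pairs at once would
    give an [h] that is good for the pair of one block. Outside that block [h] is controlled only in
    that it brings in no letter of the block. *)
Lemma transvection_block : exists j, forall p q, p <> q -> exists h,
  [/\ commute s h, h (b (E (j, p))) = b (E (j, p)) * b (E (j, q)),
    forall r, r <> p -> h (b (E (j, r))) = b (E (j, r)) &
    forall i, (forall r, E (j, r) <> i) ->
      forall r, E (j, r) \notin supp (h (b i))].
Proof.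
apply: contrapT => none.
have /choice[pq pqP] : forall j, exists pq : (F * F) * (F * F), pq.1 <> pq.2 /\
    ~ exists h, [/\ commute s h,
      h (b (E (j, pq.1))) = b (E (j, pq.1)) * b (E (j, pq.2)),
      forall r, r <> pq.1 -> h (b (E (j, r))) = b (E (j, r)) &
      forall i, (forall r, E (j, r) <> i) ->
        forall r, E (j, r) \notin supp (h (b i))].
  move=> j; apply: contrapT => h1; apply: none; exists j => p q pq.
  by apply: contrapT => h2; apply: h1; exists (p, q).
have [||h [sh [x hx] hfix hsupp]] :=
    @small_commuting_transvection s (fun j => E (j, (pq j).1))
      (fun j => E (j, (pq j).2)) s_small.
- by move=> j j' /E_inj[].
- by move=> j j' /E_inj[jj]; subst j'; case: (pqP j).
case: (pqP x) => _; apply; exists h; split => // [r rp|i xi r].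
  by apply: hfix => j /E_inj[jx e]; apply: rp; rewrite -e jx.
have [[j ji]|ni] := EM (exists j, E (j, (pq j).1) = i); last first.
  rewrite hfix => [|j ji]; last by apply: ni; exists j.
  by rewrite supp_basis inE; apply/eqP => /xi.
have jx : j <> x by move=> jx; subst j; exact: (xi _ ji).
rewrite -ji; apply/negP => /hsupp; rewrite !inE.
by case/orP => /eqP/E_inj[] /esym /jx.
Qed.

Hypothesis third : forall x y : F, exists z, z <> x /\ z <> y.

(* The commutator of two commuting multi-transvections whose supports meet in
   one basis element is an elementary transvection. *)
Lemma elementary_block : exists j, forall p q, p <> q ->
  forall t, t (b (E (j, p))) = b (E (j, p)) * b (E (j, q)) ->
    (forall i, i <> E (j, p) -> t (b i) = b i) -> commute s t.
Proof.
have [j jP] := transvection_block; exists j => p q pq t tp tfix.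
(* Row [m] avoids [p] and [q]. [h2] moves only elements of that row, and [h] will multiply [p] by
   one that [h2] multiplies by [q]. *)
have [m [mp mq]] := third p.1 q.1.
have [||h2 [sh2 [x h2x] h2fix h2supp]] :=
    @small_commuting_transvection s (fun l => E (j, (m, l))) (fun=> E (j, q))
      s_small.
- by move=> l l' /E_inj[].
- by move=> l _ /E_inj[e]; apply: mq; rewrite -e.
have pmx : p <> (m, x) by move=> e; apply: mp; rewrite e.
have [h [sh hp hfix hsupp]] := jP _ _ pmx.
(* At [p] both sides give the product of the elements at [p], [(m, x)] and [q]. Outside the block
   [h2] and [t] fix the basis and [h] brings in no letter of the block. Elsewhere in the block, [h]
   and [t] fix all letters of the image under [h2]. *)
have e : h2 * h = h * t * h2.
  apply: aut_ext => i; rewrite !autME.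
  have [[r ri]|ni] := EM (exists r, E (j, r) = i); last first.
    have ni' r : E (j, r) <> i by move=> ri; apply: ni; exists r.
    rewrite [h2 (b i)]h2fix //.
    rewrite [t (b i)]tfix; last by move=> /esym; exact: ni'.
    apply: (fix_supp (b_free := b_free)); first exact: autM.
    move=> k kh; apply: h2fix => l e; move: kh; rewrite -e.
    by apply/negP; exact: hsupp.
  subst i; have h2p : h2 (b (E (j, p))) = b (E (j, p)).
    by apply: h2fix => l /E_inj[e]; apply: mp; rewrite -e.
  have h2q : h2 (b (E (j, q))) = b (E (j, q)).
    by apply: h2fix => l /E_inj[e]; apply: mq; rewrite -e.
  have hq : h (b (E (j, q))) = b (E (j, q)) by apply: hfix => /esym.
  have [->|rp] := EM (r = p).
    by rewrite hp h2p tp !autM h2x h2p hp hq mulgA.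
  rewrite hfix //.
  have h2r : {in supp (h2 (b (E (j, r)))),
      forall k, h (b k) = b k /\ t (b k) = b k}.
    have hk k r' : k = E (j, r') -> r' <> p -> h (b k) = b k /\ t (b k) = b k.
      move=> -> r'p; split; first exact: hfix.
      by apply: tfix => /E_inj[].
    have [[l rl]|nl] := EM (exists l, r = (m, l)).
      move=> k; rewrite rl => /h2supp; rewrite !inE => /orP[]/eqP ke;
        apply: hk ke _.
        by rewrite -rl.
      by move=> /esym.
    rewrite h2fix => [k|l /E_inj[e]]; last by apply: nl; exists l; rewrite e.
    by rewrite supp_basis inE => /eqP ->; exact: hk rp.
  rewrite [t _](fix_supp (b_free := b_free)); [|exact: autM|by move=> k /h2r[]].
  by rewrite [h _](fix_supp (b_free := b_free));
    [|exact: autM|by move=> k /h2r[]].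
have -> : t = h^-1 * (h2 * h) * h2^-1 by rewrite e !mulgA mulVg mul1g mulgK.
by apply: commuteM; [apply: commuteM|];
  [exact: commuteV|apply: commuteM|exact: commuteV].
Qed.

End Blocks.

End Transvections.

(** * Images of the basis elements of a block *)

Section SplitWords.
Variables (I : eqType) (x y : I).
Hypothesis xy : x != y.

Definition split_letter (l : I * bool) : seq (I * bool) :=
  if l.1 == x
  then if l.2 then [:: (x, true); (y, true)] else [:: (y, false); (x, false)]
  else [:: l].

Definition split_word s := flatten (map split_letter s).

(** An inserted [y] could meet an inserted [y^-1] only between adjacent [x] and [x^-1], which a
    reduced word excludes. *)
Lemma split_word_reduced s :
  reduced s -> y \notin map fst s -> reduced (split_word s).
Proof.
have yx : (y == x) = false by rewrite eq_sym; exact: negPf.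
elim: s => // -[i e] [|[j e'] s] IH.
  by rewrite /split_word /split_letter /=; case: e; case: ifP => //= _ _ _;
    rewrite /noncancel /inv_letter /= xpair_eqE ?(negPf xy) ?yx ?andbF.
move=> /andP[ne rs] /=; rewrite inE negb_or => /andP[yi ys].
move: (IH rs ys) ne; rewrite /split_word /split_letter /=.
move: ys => {IH rs}; rewrite /= inE negb_or => /andP[yj _].
case: (eqVneq i x) => [->|ix]; case: (eqVneq j x) => [->|jx];
  case: e; case: e'; rewrite /= /noncancel /inv_letter /= ?xpair_eqE ?eqxx;
  rewrite ?(negPf xy) ?yx ?[j == y]eq_sym ?(negPf yj) ?[y == i]eq_sym;
  rewrite ?[i == y]eq_sym ?(negPf yi) ?(negPf jx) ?(negPf ix) ?andbT ?andbF //=;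
  rewrite ?(negPf xy) ?yx ?(negPf yi) ?(negPf yj) ?andbT ?andbF //=;
    by do ?move=> ->.
Qed.

End SplitWords.

Section Displacement.
Variables (F : groupType) (I : choiceType) (b : I -> F).
Hypothesis b_free : free_family b.
Implicit Types (s t : aut F) (g h u w : F) (i x y z : I).
Local Notation supp := (support b_free).

(** The reduced word of [t w] comes from that of [w] by writing [x * y] for [x], and it is a
    [y]-free word followed by an [x]-free one. Every inserted [y] lies in the second part, so no [x]
    follows it: [x] occurs once, with exponent 1. *)
Lemma elementary_split x y t w w' : x != y ->
    t (b x) = b x * b y -> (forall i, i != x -> t (b i) = b i) ->
    y \notin supp w -> x \notin supp w' -> w' != 1 -> t w = w * w' ->
  exists g h, [/\ w = g * b x * h, x \notin supp g, x \notin supp h,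
    {subset supp g <= supp w} & {subset supp h <= supp w}].
Proof.
move=> xy tx tfix yw xw' w'1 tw.
have t_eval v : t (eval b v) = eval b (split_word x y v).
  elim: v => [|l v IH] /=; first exact/morph_one/autM.
  rewrite autM IH /split_word /= eval_cat -/(split_word x y v); congr (_ * _).
  rewrite /split_letter; case: l => i [] /=; rewrite /eval_letter /=.
    by case: eqVneq => [->|ix] /=; rewrite ?mulg1 ?tx ?tfix.
  rewrite (morph_inv (@autM _ t)); case: eqVneq => [->|ix] /=;
    rewrite ?mulg1 ?tx ?tfix //.
  by rewrite invgM.
have nft : nf b_free (t w) = split_word x y (nf b_free w).
  by rewrite -{1}(nfK b_free w) t_eval evalK // split_word_reduced //
    nf_reduced.
have xw : x \in supp w.
  apply: contraNT w'1 => xw; apply/eqP/(@mulgI _ w); rewrite -tw mulg1.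
  apply: (fix_supp (b_free := b_free)); first exact: autM.
  by move=> i iw; apply: tfix; apply: contraNneq xw => <-.
have [p [e [q [wE xp]]]] := first_occurrence xw.
have [s1 [s2 [sE s1w s2w']]] := nf_mul b_free w w'.
have ns1 e' : (y, e') \notin s1.
  by apply: contra yw => /s1w; exact: (map_f fst).
have ns2 e' : (x, e') \notin s2.
  by apply: contra xw' => /s2w'; exact: (map_f fst).
have p_id : split_word x y p = p.
  rewrite /split_word; elim: p xp {wE} => //= l p IH;
    rewrite inE negb_or => /andP[xl /IH ->].
  by rewrite /split_letter eq_sym (negPf xl).
move: sE; rewrite -tw nft wE /split_word map_cat flatten_cat /=
  -!/(split_word x y _) p_id.
rewrite {1}/split_letter /= eqxx; case: e wE => wE sE; last first.
  (* Exponent -1 would put [x^-1] after an inserted [y^-1], hence in the [x]-free part [s2]. *)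
  by have [s3 s2E] := cat_suffix sE (ns1 _); move: (ns2 false);
    rewrite s2E mem_cat !inE eqxx !orbT.
have [s3 s2E] := @cat_suffix _ (rcons p (x, true)) (split_word x y q) s1 s2
  (y, true)
  (etrans (cat_rcons _ _ _) sE) (ns1 _).
have xq : x \notin map fst q.
  apply/negP => /mapP[[i e] q_e /= xi]; rewrite -xi in q_e.
  have: (x, e) \in split_word x y q.
    apply/flattenP; exists (split_letter x y (x, e)); first exact: map_f.
    by rewrite /split_letter eqxx; case: (e); rewrite !inE eqxx ?orbT.
  by move=> h; move: (ns2 e); rewrite s2E mem_cat inE h !orbT.
exists (eval b p), (eval b q); split.
- by rewrite -[LHS](nfK b_free) wE eval_cat /= mulgA.
- by apply: contra xp; exact: supp_eval.
- by apply: contra xq; exact: supp_eval.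
- by move=> i /supp_eval ip; rewrite /support wE map_cat mem_cat ip.
- by move=> i /supp_eval iq; rewrite /support wE map_cat mem_cat inE iq !orbT.
Qed.

Let kill y : F -> F := endo b_free (fun i => if i == y then 1 else b i).

Lemma supp_kill y w : y \notin supp (kill y w).
Proof.
have killE v : kill y (eval b v) = eval b [seq l <- v | l.1 != y].
  elim: v => [|[i e] v IH] /=; first exact/morph_one/endoM.
  rewrite /kill endoM -/(kill y) IH /eval_letter /=.
  rewrite /kill; case: e; rewrite ?(morph_inv (endoM b_free _)) endoE;
    by case: eqP => //= _; rewrite ?invg1 mul1g.
rewrite -(nfK b_free w) killE; apply/negP => /supp_eval/mapP[[i e]].
by rewrite mem_filter /= => /andP[iy _] yi; rewrite yi eqxx in iy.
Qed.

Lemma kill_id y w : y \notin supp w -> kill y w = w.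
Proof.
move=> yw; apply: (fix_supp (b_free := b_free)); first exact: endoM.
by move=> i iw; rewrite /kill endoE; case: eqP => // iy; rewrite -iy iw in yw.
Qed.

Variables (s : aut F) (X : set I).
Hypothesis X_inf : forall l : seq I, exists2 z, X z & z \notin l.
Hypothesis s_elem : forall x y, X x -> X y -> x <> y ->
  forall t, t (b x) = b x * b y -> (forall i, i != x -> t (b i) = b i) ->
  commute s t.

(** For a fresh [z] in [X], the transvection [y |-> y * z] fixes [s (b x)]. Substituting the inverse
    of [y] for [z] then erases [y] from this element without changing it. *)
Lemma supp_image x y : X x -> X y -> y \in supp (s (b x)) -> y = x.
Proof.
move=> Xx Xy ysx; apply: contrapT => yx; set w := s (b x) in ysx.
have [z Xz] := X_inf [:: x, y & supp w]; rewrite !inE !negb_or =>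
  /and3P[zx zy zw].
have yz : y != z by rewrite eq_sym.
have [t [ty tfix]] := elementary_exists b_free yz.
have st := s_elem Xy Xz (elimN eqP yz) ty tfix.
have tw : t w = w.
  by rewrite /w -(aut_commute _ st) tfix // eq_sym; apply/eqP.
pose rho := endo b_free (fun i => if i == z then (b y)^-1 else b i).
have rw : rho w = w.
  apply: (fix_supp (b_free := b_free)); first exact: endoM.
  by move=> i iw; rewrite /rho endoE; case: eqP => // iz; rewrite -iz iw in zw.
have : rho (t w) = kill y w.
  apply: (@agree_supp _ _ _ b_free _ (rho \o t) (kill y)) => [g h|g h|i iw] /=.
  - by rewrite autM /rho endoM.
  - exact: endoM.
  rewrite /kill endoE; case: (eqVneq i y) => [->|iy].
    by rewrite ty /rho endoM !endoE (negPf yz) eqxx mulgV.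
  rewrite tfix // /rho endoE; case: eqP => // iz; by rewrite -iz iw in zw.
by rewrite tw rw => e; have := supp_kill y w; rewrite -e ysx.
Qed.

(** Each [s (b x)] splits as [g * b x * h] with [g] and [h] free of letters of [X]. Comparing
    distinct [x] and [y] shows that [h] is inverse to [g] and that [g] does not depend on [x]. *)
Lemma conjugating_element : exists2 u, (forall i, X i -> i \notin supp u) &
  forall x, X x -> s (b x) = u * b x * u^-1.
Proof.
have /choice[gh ghP] : forall x, exists gh : F * F, X x ->
    s (b x) = gh.1 * b x * gh.2 /\
    forall i, X i -> i \notin supp gh.1 /\ i \notin supp gh.2.
  move=> x; have [Xx|nXx] := EM (X x); last by exists (1, 1).
  have [y Xy] := X_inf [:: x]; rewrite inE => yx.
  have xy : x != y by rewrite eq_sym.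
  have [t [tx tfix]] := elementary_exists b_free xy.
  have st := s_elem Xx Xy (elimN eqP xy) tx tfix.
  have [||||g [h [wE xg xh gw hw]]] :=
    @elementary_split x y t (s (b x)) (s (b y)) xy tx tfix.
  - by apply/negP => /(supp_image Xx Xy) /eqP; rewrite (negPf yx).
  - by apply/negP => /(supp_image Xy Xx) /eqP; rewrite (negPf xy).
  - apply/eqP => sy; have: b y = 1.
      by apply: (can_inj (autK s)); rewrite sy (morph_one (@autM _ s)).
    by move=> /(congr1 (nf b_free)); rewrite nf_basis nf_one.
  - by rewrite -(aut_commute _ st) tx autM.
  exists (g, h) => _; split => // i Xi; split; apply/negP => /= isupp.
    by have /(supp_image Xx Xi) ix := gw _ isupp;
      rewrite ix (negPf xg) in isupp.
  by have /(supp_image Xx Xi) ix := hw _ isupp; rewrite ix (negPf xh) in isupp.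
(* Apply [t] to [s (b x)], whose outer factors it fixes, and compare with [s (b x) * s (b y)]. *)
have rel x y : X x -> X y -> x <> y ->
    b y * (gh x).2 = (gh x).2 * (gh y).1 * b y * (gh y).2.
  move=> Xx Xy /eqP xy.
  have [t [tx tfix]] := elementary_exists b_free xy.
  have st := s_elem Xx Xy (elimN eqP xy) tx tfix.
  have [sx ghx] := ghP _ Xx; have [sy ghy] := ghP _ Xy.
  have tid u : x \notin supp u -> t u = u.
    move=> xu; apply: (fix_supp (b_free := b_free)); first exact: autM.
    by move=> i iu; apply: tfix; apply: contraNneq xu => <-.
  have := aut_commute (b x) st; rewrite tx autM sx sy !autM tx.
  rewrite (tid (gh x).1) ?(tid (gh x).2) ?(ghx x Xx).1 ?(ghx x Xx).2 //.
  by rewrite -!mulgA => /mulgI/mulgI e; rewrite e.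
have [x0 Xx0 _] := X_inf [::].
have gh1 y : X y -> (gh y).2 = (gh y).1^-1.
  move=> Xy; have [x Xx] := X_inf [:: y]; rewrite inE => /eqP xy.
  (* Erasing [y] leaves the two outer factors at [y] with product 1. *)
  have := rel x y Xx Xy xy; move=> /(congr1 (kill y)).
  have [_ ghx] := ghP _ Xx; have [_ ghy] := ghP _ Xy.
  have killM := endoM b_free (fun i => if i == y then 1 else b i).
  have kill_y : kill y (b y) = 1 by rewrite /kill endoE eqxx.
  rewrite /kill !killM -/(kill y) kill_y (kill_id (ghx y Xy).2).
  rewrite (kill_id (ghy y Xy).1) (kill_id (ghy y Xy).2) mul1g mulg1 -mulgA => e.
  by apply/esym/mulg1_eq/(@mulgI _ (gh x).2); rewrite mulg1.
exists (gh x0).1 => [i Xi|y Xy]; first by have [_ /(_ i Xi)[]] := ghP _ Xx0.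
have [sy ghy] := ghP _ Xy; have [_ ghx] := ghP _ Xx0.
rewrite sy gh1 //; suff -> : (gh y).1 = (gh x0).1 by [].
have [->//|yx] := EM (y = x0); have := rel x0 y Xx0 Xy (fun e => yx (esym e)).
rewrite !gh1 // => e.
(* This element has no letter [y], so commuting with [b y] makes it trivial. *)
have : commute ((gh x0).1^-1 * (gh y).1) (b y).
  by rewrite /commute [RHS]mulgA e mulgVK.
move=> /(commute_basis (b_free := b_free)) h; apply/esym/divg1_eq.
have /h c1 : y \notin supp ((gh x0).1^-1 * (gh y).1).
  apply/negP => /suppM; rewrite mem_cat (negPf (ghy y Xy).1) orbF => /suppV.
  by apply/negP; exact: (ghx y Xy).1.
by apply: invg_inj; rewrite invg1 invgF -{1}[(gh x0).1]invgK -(mulg1_eq c1)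
  mulgV.
Qed.

End Displacement.

(** * Completeness *)

Section Conjugations.
Variable G : groupType.
Implicit Types (u v x : G) (t : aut G).

Lemma conj_morph u : {morph (fun x => x ^ u^-1) : x y / x * y}.
Proof. by move=> x y; exact: conjMg. Qed.

(** As [x ^ g] is [g^-1 * x * g], the inverse makes [conj_aut] preserve products. *)
Definition conj_aut u : aut G := Aut (@conj_morph u) (conjgKV u) (conjgK u).

Lemma conj_autE u x : conj_aut u x = u * x * u^-1.
Proof. by rewrite /= conjgE invgK mulgA. Qed.

Lemma conj_autM : {morph conj_aut : u v / u * v}.
Proof. by move=> u v; apply: aut_eq => x; rewrite /= invgM conjgM. Qed.

Lemma conj_autJ u t : conj_aut u ^ t = conj_aut (t^-1 u).
Proof.
apply: aut_eq => x; rewrite conjgE !autME !conj_autE !autM.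
by rewrite -[t^-1 (t x)]/((t^-1 * t) x) mulVg (morph_inv (@autM _ t^-1)).
Qed.

(** Conjugates of a conjugation are conjugations, hence indexed by [G]. *)
Lemma conj_aut_small u : small_class G (conj_aut u).
Proof. by exists conj_aut => t; exists (t^-1 u); rewrite conj_autJ. Qed.

Lemma conj_autMJ t u : t * conj_aut u = conj_aut (t u) * t.
Proof.
have -> : conj_aut (t u) = conj_aut u ^ t^-1 by rewrite conj_autJ invgK.
by rewrite conjgE invgK mulgA mulgVK.
Qed.

End Conjugations.

Lemma small_class_morph (T : Type) (G : groupType) (alpha : aut G) (s : G) :
  small_class T s -> small_class T (alpha s).
Proof.
move=> [f fP]; exists (alpha \o f) => t; have [x fx] := fP (alpha^-1 t).
exists x; rewrite /= fx !conjgE !autM (morph_inv (@autM _ alpha)).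
by rewrite -[alpha (alpha^-1 t)]/((alpha * alpha^-1) t) mulgV.
Qed.

(* Burnside's criterion; injectivity of [conj_aut] says that [G] has trivial
   centre. *)
Lemma complete_aut (G : groupType) :
    injective (@conj_aut G) ->
    (forall (alpha : aut (aut G)) (u : G),
      exists v, alpha (conj_aut u) = conj_aut v) ->
  complete_group (aut G).
Proof.
move=> conj_inj charG; split.
  apply/seteqP; split=> [z zc|_ -> t]; last by rewrite /commute mul1g mulg1.
  apply: aut_eq => g; apply: conj_inj; apply: (@mulIg _ z).
  by rewrite -conj_autMJ; exact: zc.
move=> alpha.
(* [alpha] permutes the conjugations; injectivity of [conj_aut] turns this into an automorphism of
   [G]. *)
have /choice[beta betaE] := charG alpha.
have /choice[beta' beta'E] := charG alpha^-1.
have betaM : {morph beta : x y / x * y}.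
  by move=> x y; apply: conj_inj; rewrite conj_autM -!betaE conj_autM autM.
have betaK : cancel beta beta'.
  by move=> x; apply: conj_inj; rewrite -beta'E -betaE; exact: autK.
have betaVK : cancel beta' beta.
  by move=> x; apply: conj_inj; rewrite -betaE -beta'E; exact: autVK.
pose B : aut G := Aut betaM betaK betaVK.
(* [alpha] is [t |-> B * t * B^-1]; the convention for [x ^ g] calls for [B^-1]. *)
exists B^-1 => t.
suff e : alpha t * B = B * t by rewrite conjgE invgK mulgA -e mulgK.
apply: aut_eq => g; rewrite !autME; apply: conj_inj;
  apply: (@mulIg _ (alpha t)).
rewrite -conj_autMJ -[B g]/(beta g) -[B (t g)]/(beta (t g)) -!betaE -!autM.
by rewrite conj_autMJ.
Qed.

(** * Free groups of infinite rank *)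

Section InfiniteRank.
Variables (F : groupType) (I : choiceType) (b : I -> F) (n : nat -> I).
Hypotheses (b_free : free_family b) (n_inj : injective n).

Lemma infinite_fresh (T : choiceType) (e : nat -> T) (l : seq T) :
  injective e -> exists k, e k \notin l.
Proof.
move=> e_inj; apply: contrapT => all_in.
have: {subset map e (iota 0 (size l).+1) <= l}.
  move=> _ /mapP[k _ ->]; apply: contrapT => /negP kl; apply: all_in;
    by exists k.
move=> /uniq_leq_size; rewrite (map_inj_uniq e_inj) iota_uniq size_map
  size_iota.
by rewrite ltnn => /(_ isT).
Qed.

(** [u^-1 * v] commutes with a basis element outside its support. *)
Lemma conj_aut_inj : injective (@conj_aut F).
Proof.
move=> u v uv; have [k kuv] := infinite_fresh (support b_free (u^-1 * v)) n_inj.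
apply: invg_inj; rewrite -[LHS]mulg1 -(mulgV v) mulgA.
rewrite [u^-1 * v](commute_basis kuv) ?mul1g //.
have := congr1 (fun t : aut F => t (b (n k))) uv.
rewrite /commute !conj_autE => e.
by rewrite -mulgA -[v * _](mulgVK v) -e !mulgA mulVg mul1g -!mulgA.
Qed.

(** [F] embeds into words over [I], these into [I], and pairs from [I] into [I]. The coordinates of
    a triple serve as block, row and column. *)
Lemma triple_embedding : exists E : F * (F * F) -> I, injective E.
Proof.
have [p p_inj] := pairing_exists n_inj.
have [q q_inj] := seq_injection n_inj p_inj.
pose c g := q (nf b_free g).
have c_inj : injective c by apply: inj_comp q_inj _;
  exact: can_inj (nfK b_free).
exists (fun t => p (c t.1, p (c t.2.1, c t.2.2))) => -[x [y z]] [x' [y' z']] /=.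
by move=> /p_inj[/c_inj-> /p_inj[/c_inj-> /c_inj->]].
Qed.

(** On one block [s] is conjugation by some [u]. For [i] outside it, some [h] commuting with [s]
    multiplies an element of the block by [b i] and fixes [u]; evaluating [s] and [h] in both orders
    there determines [s (b i)]. *)
Lemma small_conj (s : aut F) : small_class F s -> exists u, s = conj_aut u.
Proof.
move=> s_small; have [E E_inj] := triple_embedding.
have e_inj : injective (b \o n) by apply: inj_comp n_inj;
  exact: basis_inj b_free.
have third (x y : F) : exists z, z <> x /\ z <> y.
  have [k] := infinite_fresh [:: x; y] e_inj; rewrite !inE negb_or =>
    /andP[/eqP kx /eqP ky].
  by exists ((b \o n) k).
have [j jP] := elementary_block b_free s_small E_inj third.
pose X := [set i | exists r, E (j, r) = i].
have XE r : X (E (j, r)) by exists r.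
have X_inf (l : seq I) : exists2 z, X z & z \notin l.
  have Ej_inj : injective (fun k => E (j, (1, (b \o n) k))).
    by move=> k k' /E_inj[] /e_inj.
  have [k kl] := infinite_fresh l Ej_inj.
  by exists (E (j, (1, (b \o n) k))).
have s_elem x y : X x -> X y -> x <> y ->
    forall t : aut F, t (b x) = b x * b y ->
    (forall i, i != x -> t (b i) = b i) -> commute s t.
  move=> [p <-] [q <-] pq t tp tfix; apply: (jP p q _ t tp) => [pq'|i /eqP ip].
    by apply: pq; rewrite pq'.
  exact: tfix.
have [u uX uE] := conjugating_element b_free X_inf s_elem.
exists u; apply: (aut_ext b_free) => i; rewrite conj_autE.
have [Xi|nXi] := EM (X i); first exact: uE.
(* Row 1 is an arbitrary choice of a family in the block indexed by [F]. *)
have [||h [sh [x hx] hfix _]] :=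
    @small_commuting_transvection _ _ _ b_free s
      (fun x => E (j, (1, x))) (fun=> i) s_small.
- by move=> x y /E_inj[].
- by move=> x _ e; apply: nXi; rewrite -e.
have hu : h u = u.
  apply: (fix_supp (b_free := b_free)); first exact: autM.
  move=> k ku; apply: hfix => y yk; have /uX : X k by exists (1, y).
  by rewrite ku.
have := aut_commute (b (E (j, (1, x)))) sh; rewrite hx autM uE // !autM hx.
rewrite (morph_inv (@autM _ h)) hu -!mulgA => /mulgI/mulgI e.
by apply: (@mulgI _ u^-1); rewrite e mulKg.
Qed.

Lemma complete_aut_infinite_rank : complete_group (aut F).
Proof.
apply: complete_aut; first exact: conj_aut_inj.
by move=> alpha u; apply: small_conj; apply: small_class_morph;
  exact: conj_aut_small.
Qed.

End InfiniteRank.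

(** Every element is the value of its normal form. Hence a basis of a group that is not finitely
    generated is infinite. *)
Lemma basis_generates (F : groupType) (B : set F) :
  free_basis B -> generated_subgroup B = setT.
Proof.
move=> /free_basis_family B_free; apply/seteqP;
  split=> // g _ H [[H1 HM HV] BH].
rewrite -(nfK B_free g); elim: (nf _ g) => [//|[[x Bx] e] v IH] /=.
apply: HM => //; have Hx : H x by apply: BH; exact: set_mem.
by case: e; rewrite /eval_letter //=; exact: HV.
Qed.

Theorem theorem4p4 (F : groupType) (F_free : free_group F)
    (F_inf_gen : ~ finitely_generated F) :
  complete_group (aut F).
Proof.
have [B B_free] := F_free.
have B_inf : infinite_set B.
  by move=> B_fin; apply: F_inf_gen; exists B => //; exact: basis_generates.
have /card_leP[n] := (infiniteP B).1 B_inf.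
have nI : injective n by move=> k k' /inj; apply; rewrite inE.
pose e k := n (SigSub (mem_set (I : [set: nat] k))).
apply: (@complete_aut_infinite_rank _ _ _ e (free_basis_family B_free)).
by move=> k k' /nI[].
Qed.
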